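(* Let $f(w):=w^p$ for $w\ge 0$, for some $0<p<1$. Let $\delta>0$, let $g$ be the $\delta$-smoothing of $f$ with coefficients $g_1,g_2,g_3$, and let $h(w):=f(w+\hat\lambda)-f(\hat\lambda)$ for $w\ge0$, where $\hat\lambda>0$ is chosen so that $h'(0)=g'(0)=g_1$, i.e. $\hat\lambda=(f')^{-1}(g_1)$. Then $h(w)\le g(w)$ for all $w\in[0,+\infty)$.
   Context: For $f$ on $[0,+\infty)$ with $f(0)=0$ and $f$ twice differentiable at $\delta>0$, the $\delta$-smoothing of $f$ is the function $g$ on $[0,+\infty)$ defined by $g(w)=g_1w+\frac12 g_2w^2+\frac16 g_3w^3$ for $0\le w\le\delta$ and $g(w)=f(w)$ for $w>\delta$, where $$g_1=\frac{3f(\delta)}{\delta}-2f'(\delta)+\frac{\delta f''(\delta)}{2},\quad g_2=-\frac{6f(\delta)}{\delta^2}+\frac{6f'(\delta)}{\delta}-2f''(\delta),\quad g_3=\frac{6f(\delta)}{\delta^3}-\frac{6f'(\delta)}{\delta^2}+\frac{3f''(\delta)}{\delta}.$$ *)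

(* Defs.v *)
From mathcomp Require Import all_boot all_order all_algebra.
From mathcomp Require Import all_classical all_reals all_analysis.

Set Implicit Arguments.
Unset Strict Implicit.
Unset Printing Implicit Defensive.

Import Order.TTheory GRing.Theory Num.Theory.
Import numFieldNormedType.Exports.

Local Open Scope ring_scope.

(* Functions on [0, +oo[ are represented by total functions R -> R; only their
   values at w >= 0 are meaningful. The derivatives below are taken at delta > 0,
   an interior point of the domain, so they do not depend on the extension. *)

Definition smooth_coef1 (R : realType) (f : R -> R) (delta : R) : R :=
  3 * f delta / delta - 2 * derive1 f delta + delta * derive1n 2 f delta / 2.

Definition smooth_coef2 (R : realType) (f : R -> R) (delta : R) : R :=
  - (6 * f delta / delta ^+ 2) + 6 * derive1 f delta / delta - 2 * derive1n 2 f delta.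

Definition smooth_coef3 (R : realType) (f : R -> R) (delta : R) : R :=
  6 * f delta / delta ^+ 3 - 6 * derive1 f delta / delta ^+ 2
  + 3 * derive1n 2 f delta / delta.

Definition smoothing (R : realType) (f : R -> R) (delta w : R) : R :=
  if w <= delta then
    smooth_coef1 f delta * w + 1 / 2 * smooth_coef2 f delta * w ^+ 2
    + 1 / 6 * smooth_coef3 f delta * w ^+ 3
  else f w.

(* For 0 < p, [powR] gives 0 at w = 0, as required of w ^ p. *)
Definition power_fun (R : realType) (p w : R) : R := w `^ p.

(* For lambda > 0 and f differentiable on ]0, +oo[, the two-sided derivative of
   [shifted f lambda] at 0 is f'(lambda) and agrees with the one-sided one. *)
Definition shifted (R : realType) (f : R -> R) (lambda w : R) : R :=
  f (w + lambda) - f lambda.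

(* Main.v *)
Require Import Defs.
From mathcomp Require Import all_boot all_order all_algebra.
From mathcomp Require Import all_classical all_reals all_analysis.
From mathcomp Require Import ring lra.
Import Order.TTheory GRing.Theory Num.Theory.
Import numFieldNormedType.Exports.
Local Open Scope ring_scope.

(** Put [f w = w `^ p], let [h] be the shift of [f] and [g] its smoothing.
    Beyond [delta] the inequality is the subadditivity of [w `^ p].
    On [0, delta] the difference [e = h - g] vanishes at [0], so it is enough
    that [e'] is nonpositive there.  Three things are known about [e']:
    - [e' 0 = 0], which is the choice of [lambda];
    - [e' delta <= 0 <= e'' delta], because the cubic agrees with [f] up to
      second order at [delta], while [f'] decreases, [f''] increases and [h] is
      [f], up to a constant, moved to the left by [lambda];
    - [e''] is concave, being [p (p - 1) (w + lambda) `^ (p - 2)], a negative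
      multiple of a convex function, minus an affine function.
    By concavity and [0 <= e'' delta], the function [e''] changes sign at most
    once on [0, delta], from negative to positive.  Hence [e'] first decreases
    and then increases, and lies below the larger of its values at the two
    ends, neither of which is positive ([deriv_quasiconcave_le0]).  The explicit
    values of [lambda] and of the coefficients of the cubic never enter. *)

Lemma le_of_derive_le0 (R : realType) (F dF : R -> R) (a b : R) :
  a <= b -> (forall x, a <= x <= b -> is_derive x 1 F (dF x)) ->
  (forall x, a <= x <= b -> dF x <= 0) -> F b <= F a.
Proof.
move=> ab dFE dF0.
have [||c cab e] := @MVT_segment R F dF a b ab.
- by move=> x; rewrite in_itv/= => /andP[ax xb]; apply: dFE; rewrite !ltW.
- apply: derivable_within_continuous => x; rewrite in_itv/= => xab.
  by have ? := dFE x xab; exact: ex_derive.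
rewrite -subr_le0 e mulr_le0_ge0 ?subr_ge0//.
by apply: dF0; move: cab; rewrite in_itv.
Qed.

Lemma ge_of_derive_ge0 (R : realType) (F dF : R -> R) (a b : R) :
  a <= b -> (forall x, a <= x <= b -> is_derive x 1 F (dF x)) ->
  (forall x, a <= x <= b -> 0 <= dF x) -> F a <= F b.
Proof.
move=> ab dFE dF0; rewrite -lerN2.
apply: (@le_of_derive_le0 R (- F) (- dF) a b ab) => x xab.
  by have ? := dFE x xab; exact: is_deriveN.
by rewrite /= oppr_le0; exact: dF0.
Qed.

(** If [v w < 0] then [v] has no positive value to the left of [w], since it is
    nonnegative at [d]; so [u] decreases from [0] to [w].  Otherwise [v] is
    nonnegative between [w] and [d], so [u] increases from [w] to [d]. *)
Lemma deriv_quasiconcave_le0 (R : realType) (u v : R -> R) (d : R) :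
  (forall x, 0 <= x <= d -> is_derive x 1 u (v x)) ->
  (forall a b c, 0 <= a -> a <= b -> b <= c -> c <= d ->
     Num.min (v a) (v c) <= v b) ->
  u 0 <= 0 -> u d <= 0 -> 0 <= v d ->
  forall w, 0 <= w <= d -> u w <= 0.
Proof.
move=> uv qv u0 ud vd w /andP[w0 wd].
have [vw0|vw0] := leP 0 (v w).
- apply: le_trans ud; apply: (@ge_of_derive_ge0 R u v) => // x /andP[wx xd].
    by apply: uv; rewrite (le_trans w0).
  by apply: le_trans (qv w x d w0 wx xd (lexx _)); rewrite le_min vw0.
- apply: le_trans u0; apply: (@le_of_derive_le0 R u v) => // x /andP[x0 xw].
    by apply: uv; rewrite x0 (le_trans xw).
  rewrite leNgt; apply/negP => vx.
  have := qv x w d x0 xw wd (lexx _).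
  by rewrite leNgt lt_min !(lt_le_trans vw0) // ltW.
Qed.

(** For [x > 0] the power is the convex increasing [expR] applied to the convex
    [a * ln x]. *)
Lemma convex_powR_le0 (R : realType) (a : R) (t : {i01 R}) (x y : R) :
  a <= 0 -> 0 < x -> 0 < y ->
  (t%:num * x + (1 - t%:num) * y) `^ a
    <= t%:num * x `^ a + (1 - t%:num) * y `^ a.
Proof.
move=> a0 x0 y0.
have c0 : 0 < t%:num * x + (1 - t%:num) * y by exact: (@convR_gt0 R x y t x0 y0).
rewrite /powR !gt_eqF//.
apply: le_trans (convex_expR t (a * ln x) (a * ln y)).
rewrite ler_expR convRE.
have := concave_ln t x0 y0; rewrite !convRE => H.
by have := ler_wnM2l a0 H; congr (_ <= _); ring.
Qed.

Lemma concave_min_le (R : realType) (v : R -> R) (a b c : R) :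
  (forall t : {i01 R}, t%:num * v a + (1 - t%:num) * v c
     <= v (t%:num * a + (1 - t%:num) * c)) ->
  a <= b -> b <= c -> Num.min (v a) (v c) <= v b.
Proof.
move=> cv ab bc; have [ac|ca] := ltP a c; last first.
  have -> : b = a by apply: le_anti; rewrite ab (le_trans bc).
  by rewrite ge_min lexx.
have ca0 : 0 < c - a by rewrite subr_gt0.
have t0 : 0 <= (c - b) / (c - a) by rewrite divr_ge0 ?subr_ge0// ltW.
have t1 : (c - b) / (c - a) <= 1 by rewrite ler_pdivrMr// mul1r lerD2l lerN2.
have := cv (Itv01 t0 t1).
rewrite /=; set t := _ / _.
have -> : t * a + (1 - t) * c = b by rewrite /t; field; rewrite gt_eqF.
apply: le_trans.
have ma : Num.min (v a) (v c) <= v a by rewrite ge_min lexx.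
have mc : Num.min (v a) (v c) <= v c by rewrite ge_min lexx orbT.
have s0 : 0 <= 1 - t by rewrite subr_ge0.
have := ler_wpM2l t0 ma; have := ler_wpM2l s0 mc; rewrite -/t; lra.
Qed.

Lemma powR_le0_anti (R : realType) (a x y : R) :
  a <= 0 -> 0 < x -> x <= y -> y `^ a <= x `^ a.
Proof.
move=> a0 x0 xy; have y0 := lt_le_trans x0 xy.
by rewrite /powR !gt_eqF// ler_expR ler_wnM2l// ler_ln.
Qed.

(** Each summand [x] of the base satisfies
    [x * (x + y) `^ (p - 1) <= x * x `^ (p - 1)]. *)
Lemma powR_subadditive (R : realType) (p x y : R) :
  0 < p -> p <= 1 -> 0 < x -> 0 < y -> (x + y) `^ p <= x `^ p + y `^ p.
Proof.
move=> p0 p1 x0 y0.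
have x0' := ltW x0; have y0' := ltW y0.
have p1' : p - 1 <= 0 by rewrite subr_le0.
rewrite -(@mulr_powRB1 _ (x + y)) ?addr_ge0// mulrDl.
rewrite -(@mulr_powRB1 _ x)// -(@mulr_powRB1 _ y)//.
by apply: lerD; rewrite ler_wpM2l// powR_le0_anti// ?lerDl ?lerDr.
Qed.

Lemma is_derive_powR_shift (R : realType) (a l w : R) : 0 < w + l ->
  is_derive w 1 (fun x => (x + l) `^ a) (a * (w + l) `^ (a - 1)).
Proof.
move=> wl.
have ? := is_derive1_powR a wl.
have D : is_derive w 1 (fun x : R => x + l) 1.
  by apply: is_derive_eq; rewrite addr0.
rewrite -[_ * _ `^ _]mulr1.
exact: (@is_derive1_comp R (fun y => y `^ a) (fun x => x + l) w).
Qed.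

Lemma derive1_power_fun (R : realType) (p d : R) : 0 < d ->
  derive1 (power_fun p) d = p * d `^ (p - 1).
Proof.
move=> d0; rewrite derive1E; have ? := is_derive1_powR p d0.
exact: derive_val.
Qed.

Lemma derive1n2_power_fun (R : realType) (p d : R) : 0 < d ->
  derive1n 2 (power_fun p) d = p * (p - 1) * d `^ (p - 2).
Proof.
move=> d0; rewrite /derive1n /= derive1E.
rewrite (@near_eq_derive _ _ _ _ (p \*: (fun y => y `^ (p - 1)))); last first.
  near=> x; rewrite /= derive1_power_fun//.
  by near: x; exact: lt_nbhsr.
have ? := is_derive1_powR (p - 1) d0.
rewrite deriveZ//= derive_val /GRing.scale/= mulrA; congr (_ * _ `^ _); ring.
Unshelve. end_near. Qed.

Lemma derive1_shifted_power_fun (R : realType) (p l : R) : 0 < l ->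
  derive1 (shifted (power_fun p) l) 0 = p * l `^ (p - 1).
Proof.
move=> l0; rewrite derive1E.
have l0' : 0 < 0 + l by rewrite add0r.
have ? := is_derive_powR_shift _ p _ _ l0'.
rewrite /shifted /power_fun.
have -> : (fun w => (w + l) `^ p - l `^ p)
          = (fun w => (w + l) `^ p) - cst (l `^ p) by [].
by rewrite deriveB// derive_val derive_cst subr0 add0r.
Qed.

(** The coefficients are the solution of the three matching conditions at
    [delta]; these two lemmas recover the ones on first and second
    derivatives. *)
Lemma smooth_coef_derive1 (R : realType) (f : R -> R) (d : R) : 0 < d ->
  smooth_coef1 f d + smooth_coef2 f d * d + smooth_coef3 f d / 2 * d ^+ 2
  = derive1 f d.
Proof.
move=> d0; rewrite /smooth_coef1 /smooth_coef2 /smooth_coef3.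
by field; rewrite gt_eqF.
Qed.

Lemma smooth_coef_derive2 (R : realType) (f : R -> R) (d : R) : 0 < d ->
  smooth_coef2 f d + smooth_coef3 f d * d = derive1n 2 f d.
Proof.
move=> d0; rewrite /smooth_coef2 /smooth_coef3.
by field; rewrite gt_eqF.
Qed.

(** The comparison on [0, d] for an arbitrary cubic without constant term: only
    its first derivative at [0] and its first two derivatives at [d] matter. *)
Lemma shifted_power_le_cubic (R : realType) (p l d a b c : R) :
  0 < p -> p < 1 -> 0 < l -> 0 < d ->
  p * l `^ (p - 1) = a ->
  p * d `^ (p - 1) = a + b * d + c / 2 * d ^+ 2 ->
  p * (p - 1) * d `^ (p - 2) = b + c * d ->
  forall w : R, 0 <= w <= d ->
    shifted (power_fun p) l w <= a * w + 1 / 2 * b * w ^+ 2 + 1 / 6 * c * w ^+ 3.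
Proof.
move=> p0 p1 l0 d0 Ea Eb Ec w /andP[w0 wd].
have pp : p * (p - 1) <= 0 by apply: mulr_ge0_le0; lra.
have dpos : d <= d + l by rewrite lerDl ltW.
have pos (x : R) : 0 <= x -> 0 < x + l by move=> x0; rewrite ltr_wpDl.
pose e x := (x + l) `^ p - (a * x + 1 / 2 * b * x ^+ 2 + 1 / 6 * c * x ^+ 3).
pose u x := p * (x + l) `^ (p - 1) - (a + b * x + c / 2 * x ^+ 2).
pose v x := p * (p - 1) * (x + l) `^ (p - 2) - (b + c * x).
have eu (x : R) : 0 <= x -> is_derive x 1 e (u x).
  move=> x0; have ? := is_derive_powR_shift _ p _ _ (pos x x0).
  apply: is_derive_eq.
  by rewrite /u /GRing.scale /=; field.
have uv (x : R) : 0 <= x -> is_derive x 1 u (v x).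
  move=> x0; have ? := is_derive_powR_shift _ (p - 1) _ _ (pos x x0).
  apply: is_derive_eq.
  rewrite /v /GRing.scale /= (_ : p - 1 - 1 = p - 2); last by ring.
  by field.
have qv (x y z : R) : 0 <= x -> x <= y -> y <= z -> z <= d ->
    Num.min (v x) (v z) <= v y.
  move=> x0 xy yz zd; apply: concave_min_le => // t.
  have z0 : 0 <= z by rewrite (le_trans x0) ?(le_trans xy).
  have p2 : p - 2 <= 0 by lra.
  have := convex_powR_le0 _ _ t _ _ p2 (pos x x0) (pos z z0).
  rewrite (_ : t%:num * (x + l) + (1 - t%:num) * (z + l)
             = t%:num * x + (1 - t%:num) * z + l); last by ring.
  move=> /(ler_wnM2l pp); rewrite /v; lra.
have u0 : u 0 <= 0 by rewrite /u add0r Ea; lra.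
have ud : u d <= 0.
  rewrite /u -Eb -mulrBr mulr_ge0_le0 ?(ltW p0)// subr_le0 powR_le0_anti//.
  by rewrite subr_le0 ltW.
have vd : 0 <= v d.
  rewrite /v -Ec -mulrBr mulr_le0// subr_le0 powR_le0_anti//; lra.
have ule := @deriv_quasiconcave_le0 R u v d _ qv u0 ud vd.
suff : e w <= e 0.
  by rewrite /e /shifted /power_fun add0r expr0n/= expr0n/=; lra.
apply: (@le_of_derive_le0 R e u) => // x /andP[x0 xw]; first exact: eu.
by apply: ule => [y /andP[y0 _]|]; [exact: uv|rewrite x0 (le_trans xw)].
Qed.

Theorem corollary4p2 (R : realType) (p delta lambda : R)
    (hp : 0 < p < 1) (hdelta : 0 < delta) (hlambda : 0 < lambda)
    (hchoice : derive1 (shifted (power_fun p) lambda) 0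
               = smooth_coef1 (power_fun p) delta) :
  forall w : R, 0 <= w ->
    shifted (power_fun p) lambda w <= smoothing (power_fun p) delta w.
Proof.
move=> w w0; have /andP[p0 p1] := hp.
rewrite /smoothing; case: ifPn => [wd|].
- apply: (@shifted_power_le_cubic R p lambda delta) => //.
  + by rewrite -derive1_shifted_power_fun.
  + by rewrite smooth_coef_derive1// derive1_power_fun.
  + by rewrite smooth_coef_derive2// derive1n2_power_fun.
  + by rewrite w0.
- rewrite -ltNge => dw; rewrite /shifted /power_fun lerBlDr.
  by apply: powR_subadditive => //; [exact: ltW|exact: lt_trans dw].
Qed.
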